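(* For all graphs $G$ and $H$, $$\gamma_{gr}^{t}(G\boxtimes H)\ \ge\ \max\{\,\gamma_{gr}^{t}(H)\,a(D)+(|\widehat{D}|-a(D))\,\gamma_{gr}(H)\ :\ D\text{ is a dominating sequence of }G\,\}.$$
   Context: Graphs are finite, simple and undirected, with nonempty vertex set. $N(v)$ and $N[v]=N(v)\cup\{v\}$ denote open and closed neighborhoods. A legal open neighborhood sequence of a graph is a sequence $(v_1,\ldots,v_k)$ of distinct vertices with $N(v_i)\setminus\bigcup_{j=1}^{i-1}N(v_j)\neq\emptyset$ for each $i$; its maximum length is the Grundy total domination number $\gamma_{gr}^{t}$ ($0$ if there are no edges). A dominating sequence (legal closed neighborhood sequence) is a sequence $(d_1,\ldots,d_k)$ of distinct vertices with $N[d_i]\setminus\bigcup_{j=1}^{i-1}N[d_j]\neq\emptyset$ for each $i$; its maximum length is the Grundy domination number $\gamma_{gr}$. For a dominating sequence $D=(d_1,\ldots,d_k)$, $\widehat{D}=\{d_1,\ldots,d_k\}$ and $a(D)$ is the number of vertices $d_i$ of $D$ that are not adjacent to any vertex from $\{d_1,\ldots,d_{i-1}\}$. The strong product $G\boxtimes H$ has vertex set $V(G)\times V(H)$, and $(g_1,h_1)$, $(g_2,h_2)$ are adjacent iff $g_1g_2\in E(G)$ and $h_1=h_2$, or $g_1=g_2$ and $h_1h_2\in E(H)$, or $g_1g_2\in E(G)$ and $h_1h_2\in E(H)$. *)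

(* Defs.v *)
From mathcomp Require Import all_boot.

Set Implicit Arguments.
Unset Strict Implicit.
Unset Printing Implicit Defensive.

Record sgraph := SGraph {
  vertex :> finType;
  adj : rel vertex;
  adj_sym : symmetric adj;
  adj_irrefl : irreflexive adj;
  vertex_nonempty : 0 < #|{: vertex}| }.

Definition openN (G : sgraph) (v : G) : {set G} := [set u | adj v u].

Definition closedN (G : sgraph) (v : G) : {set G} := v |: openN v.

Definition legal (T : finType) (N : T -> {set T}) (s : seq T) : bool :=
  uniq s &&
  [forall i : 'I_(size s),
     N (tnth (in_tuple s) i)
       :\: \bigcup_(j < size s | j < i) N (tnth (in_tuple s) j) != set0].

Definition legal_open_seq (G : sgraph) (s : seq G) : bool := legal (@openN G) s.

Definition dominating_seq (G : sgraph) (s : seq G) : bool :=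
  legal (@closedN G) s.

(* Maximum of f over the sequences satisfying P, for a P that holds only of
   duplicate-free sequences: these have length at most #|T|, so the range is
   exhaustive (see max_seq_geq and max_seq_attained). *)
Definition max_seq (T : finType) (P : pred (seq T)) (f : seq T -> nat) : nat :=
  \max_(k < #|T|.+1) \max_(t : k.-tuple T | P t) f t.

Definition grundy_total (G : sgraph) : nat :=
  max_seq (@legal_open_seq G) size.

Definition grundy (G : sgraph) : nat := max_seq (@dominating_seq G) size.

(* Counts positions rather than vertices; the two agree since the terms of a
   dominating sequence are distinct. *)
Definition a_num (G : sgraph) (D : seq G) : nat :=
  #|[set i : 'I_(size D) | [forall j : 'I_(size D),
       (j < i) ==> ~~ adj (tnth (in_tuple D) i) (tnth (in_tuple D) j)]]|.

Section StrongProduct.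
Variables G H : sgraph.

Definition strong_adj : rel (G * H) := fun p q =>
  [|| adj p.1 q.1 && (p.2 == q.2),
      (p.1 == q.1) && adj p.2 q.2
    | adj p.1 q.1 && adj p.2 q.2].

Lemma strong_adj_sym : symmetric strong_adj.
Proof.
move=> p q; rewrite /strong_adj (adj_sym p.1) (adj_sym p.2).
by rewrite (eq_sym p.1) (eq_sym p.2).
Qed.

Lemma strong_adj_irrefl : irreflexive strong_adj.
Proof. by move=> p; rewrite /strong_adj !adj_irrefl /= andbF. Qed.

Lemma strong_nonempty : 0 < #|{: G * H}|.
Proof. by rewrite card_prod muln_gt0 !vertex_nonempty. Qed.

Definition strong_product : sgraph :=
  SGraph strong_adj_sym strong_adj_irrefl strong_nonempty.

End StrongProduct.

Lemma max_seq_geq (T : finType) (P : pred (seq T)) (f : seq T -> nat)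
    (s : seq T) :
  (forall t, P t -> uniq t) -> P s -> f s <= max_seq P f.
Proof.
move=> Pu Ps; have ltk : size s < #|T|.+1.
  by rewrite ltnS -(card_uniqP (Pu _ Ps)) max_card.
apply: leq_trans (leq_bigmax (Ordinal ltk)) => /=.
exact: (@leq_bigmax_cond _ (fun t : (size s).-tuple T => P t)
         (fun t => f t) (in_tuple s)).
Qed.

Lemma max_seq_attained (T : finType) (P : pred (seq T)) (f : seq T -> nat)
    (s0 : seq T) :
  (forall t, P t -> uniq t) -> P s0 -> exists2 s, P s & max_seq P f = f s.
Proof.
move=> Pu Ps0.
have [m0 | m_gt0] := posnP (max_seq P f).
  exists s0 => //; apply/eqP; rewrite eq_sym m0 -leqn0 -m0.
  exact: max_seq_geq.
move: m_gt0; rewrite /max_seq.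
have [|k ->] := @eq_bigmax 'I_#|T|.+1
  (fun k : 'I__ => \max_(t : k.-tuple T | P t) f t).
  by rewrite card_ord.
move=> m_gt0.
have [|t Pt ->] := @eq_bigmax_cond _ (fun t : k.-tuple T => P t)
  (fun t : k.-tuple T => f t); last by exists t.
rewrite lt0n; apply: contraTneq m_gt0 => /card0_eq P0.
by rewrite big_pred0.
Qed.

Lemma legal_uniq (T : finType) (N : T -> {set T}) (s : seq T) :
  legal N s -> uniq s.
Proof. by case/andP. Qed.

Lemma a_num_le (G : sgraph) (D : seq G) :
  dominating_seq D -> a_num D <= #|[set x in D]|.
Proof.
move=> /legal_uniq uD; rewrite cardsE (card_uniqP uD).
by rewrite -[leqRHS]card_ord max_card.
Qed.

(* Main.v *)
Require Import Defs.
From mathcomp Require Import all_boot.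

Set Implicit Arguments.
Unset Strict Implicit.
Unset Printing Implicit Defensive.

(** Let [D] be a dominating sequence of [G] and [S], [S'] longest open and
    closed legal sequences of [H].  Replace every term [d] of [D] by the block
    [{d} x S] if [d] is adjacent to no earlier term, and by [{d} x S']
    otherwise.  In the first case [d] itself is outside the closed
    neighborhoods of the earlier terms, so [(d, y)] with [y] new for [s] is new
    for [(d, s)].  In the second case a vertex [x] new for [d] differs from [d],
    hence [x] is adjacent to [d], and [(x, y)] is adjacent to [(d, s)] exactly
    when [y] is in the closed neighborhood of [s]. *)

(** Distinctness comes for free: a repeated term would have its new vertex covered already by its
    first occurrence. The default [x0] is never reached, as [i < size s]. *)
Lemma legalP (T : finType) (N : T -> {set T}) (x0 : T) (s : seq T) :
  reflect (forall i, i < size s ->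
             exists2 y, y \in N (nth x0 s i)
                      & forall z, z \in take i s -> y \notin N z)
          (legal N s).
Proof.
apply: (iffP idP) => [/andP[_ /forallP Ns] i lt_i | Ns].
  have /set0Pn[y /setDP[Ny /bigcupP Ey]] := Ns (Ordinal lt_i).
  exists y; first by rewrite (tnth_nth x0) in Ny.
  move=> z /(nthP x0)[j]; rewrite size_take lt_i => lt_j <-.
  rewrite nth_take //; apply: contra_notN Ey => Nj.
  exists (Ordinal (ltn_trans lt_j lt_i)) => //.
  by rewrite (tnth_nth x0).
apply/andP; split.
  apply/(uniqP x0) => i j; rewrite !inE.
  wlog lt_ij : i j / i < j => [IH lt_i lt_j Eij|].
    case: (ltngtP i j) => // [|] lt_ij; first exact: IH.
    by apply/esym/IH.
  move=> lt_i /[dup] lt_j /Ns[y Ny Ey] Eij; have /negP[] : y \notin N (nth x0 s i).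
    by apply: Ey; rewrite -(nth_take x0 lt_ij) mem_nth // size_take lt_j.
  by rewrite Eij.
apply/forallP => i; have [y Ny Ey] := Ns i (ltn_ord i).
apply/set0Pn; exists y; rewrite inE (tnth_nth x0) Ny andbT.
apply/bigcupP => -[j lt_ji]; rewrite (tnth_nth x0) /=; apply/negP/Ey.
by rewrite -(nth_take x0 lt_ji) mem_nth // size_take ltn_ord.
Qed.

Lemma legal_nil (T : finType) (N : T -> {set T}) : legal N [::].
Proof. by apply/andP; split=> //; apply/forallP => -[]. Qed.

(** Each position's condition looks only at the prefix before it, which appending [x] leaves
    unchanged; this allows induction from the right. *)
Lemma legal_rconsP (T : finType) (N : T -> {set T}) (s : seq T) (x : T) :
  legal N (rcons s x) <->
  legal N s /\ exists2 y, y \in N x & forall z, z \in s -> y \notin N z.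
Proof.
have take_rcons i : i <= size s -> take i (rcons s x) = take i s.
  by move=> le_i; rewrite -cats1 takel_cat.
split=> [/(legalP _ x) Ns | [/(legalP _ x) Ns Nx]].
  split; last first.
    have := Ns (size s); rewrite size_rcons nth_rcons ltnn eqxx.
    by rewrite take_rcons // take_size; apply.
  apply/(legalP _ x) => i lt_i; have := Ns i.
  rewrite size_rcons nth_rcons lt_i take_rcons 1?ltnW //.
  by apply.
apply/(legalP _ x) => i; rewrite size_rcons ltnS => le_i.
rewrite take_rcons // nth_rcons; case: ltngtP le_i => // [lt_i|->] _.
  exact: Ns.
by rewrite take_size.
Qed.

(** Common pattern of both kinds of block: [f] places the terms and [phi] the new vertices. They are
    separate maps because the two may lie in different fibers of the product. *)
Lemma legal_cat_map (U T : finType) (M : U -> {set U}) (N : T -> {set T})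
    (f phi : U -> T) (L : seq T) (s : seq U) :
  (forall u y, (phi y \in N (f u)) = (y \in M u)) ->
  (forall z y, z \in L -> phi y \notin N z) ->
  legal N L -> legal M s -> legal N (L ++ map f s).
Proof.
move=> NM NL legL; elim/last_ind: s => [|s x IH]; first by rewrite cats0.
move=> /legal_rconsP[/IH legLs [y My Ey]].
rewrite map_rcons -rcons_cat; apply/legal_rconsP; split=> //.
exists (phi y); first by rewrite NM.
move=> z; rewrite mem_cat => /orP[/NL //|/mapP[u s_u ->]].
by rewrite NM Ey.
Qed.

(** A sum over positions with prefixes [take i D] lets the last term be split off. *)
Lemma a_num_sum (G : sgraph) (x0 : G) (D : seq G) :
  a_num D =
  \sum_(i < size D) all (fun z => ~~ adj (nth x0 D i) z) (take i D).
Proof.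
rewrite /a_num cardsE -sum1_card big_mkcond; apply: eq_bigr => i _ /=.
rewrite unfold_in -[LHS]/(nat_of_bool _); congr nat_of_bool.
apply/forallP/allP => Ai => [z /(nthP x0)[j] | j].
  rewrite size_take ltn_ord => lt_ji <-.
  have := Ai (Ordinal (ltn_trans lt_ji (ltn_ord i))).
  by rewrite !(tnth_nth x0) /= lt_ji nth_take.
apply/implyP => lt_ji; rewrite !(tnth_nth x0); apply: Ai.
by rewrite -(nth_take x0 lt_ji) mem_nth // size_take ltn_ord.
Qed.

Lemma a_num_nil (G : sgraph) : a_num ([::] : seq G) = 0.
Proof. by apply/eqP; rewrite -leqn0 -[leqRHS](card_ord 0) max_card. Qed.

Lemma a_num_rcons (G : sgraph) (D : seq G) (x : G) :
  a_num (rcons D x) = a_num D + all (fun z => ~~ adj x z) D.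
Proof.
rewrite !(a_num_sum x) size_rcons big_ord_recr /=; congr (_ + _).
  apply: eq_bigr => i _.
  by rewrite nth_rcons ltn_ord -cats1 takel_cat // ltnW.
by rewrite nth_rcons ltnn eqxx -cats1 takel_cat // take_size.
Qed.

Lemma in_openN_strong (G H : sgraph) (p q : strong_product G H) :
  (q \in openN p) =
  [&& q.1 \in closedN p.1, q.2 \in closedN p.2 & q != p].
Proof.
case: p q => [g h] [g' h']; rewrite !inE /= /strong_adj /= xpair_eqE.
rewrite (eq_sym h h') (eq_sym g g').
case: (eqVneq g' g) => [->|_]; case: (eqVneq h' h) => [->|_];
  by rewrite ?adj_irrefl /= ?andbF ?andbT ?orbF.
Qed.

(** Induction on [D] from the right. The condition on first coordinates is the invariant that makes
    a new block independent of all earlier ones. *)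
Lemma strong_legal_seq (G H : sgraph) (S S' : seq H) (D : seq G) :
  legal_open_seq S -> dominating_seq S' -> dominating_seq D ->
  exists L : seq (strong_product G H),
    [/\ legal_open_seq L, forall p, p \in L -> p.1 \in D
      & size L = size S * a_num D + (size D - a_num D) * size S'].
Proof.
move=> legS legS'; elim/last_ind: D => [|D d IH] legD.
  by exists [::]; split=> //; [exact: legal_nil | rewrite a_num_nil muln0].
have /legal_rconsP[/[dup] domD /IH[L [legL LD sizeL]] [x dx Dx]] := legD.
have Dd : d \notin D.
  by have := legal_uniq legD; rewrite rcons_uniq => /andP[].
(* Keeps the truncated subtraction exact when [size D] grows by one. *)
have le_aD : a_num D <= size D.
  by have := a_num_le domD; rewrite cardsE (card_uniqP (legal_uniq domD)).
have outside g y (p : strong_product G H) :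
    (forall z, z \in D -> g \notin closedN z) ->
  p \in L -> (g, y) \notin @openN (strong_product G H) p.
  by move=> Dg /LD/Dg; rewrite in_openN_strong /= => /negbTE->.
have inD (s : seq H) (p : strong_product G H) :
  p \in L ++ [seq (d, h) | h <- s] -> p.1 \in rcons D d.
  rewrite mem_rcons inE mem_cat => /orP[/LD->|/mapP[h _ ->]].
    by rewrite orbT.
  by rewrite eqxx.
have [nadj | adj_d] := boolP (all (fun z => ~~ adj d z) D).
  exists (L ++ [seq (d, h) | h <- S]); split; last 2 first.
  - exact: inD.
  - rewrite size_cat size_map sizeL a_num_rcons nadj size_rcons addn1 subSS.
    by rewrite mulnS addnAC (addnC (size S)).
  (* Terms and new vertices share the fiber over [d], where adjacency is that of [H]. *)
  apply: (@legal_cat_map _ _ (@openN H) _ _ (pair d)) => // [u y|p y].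
    rewrite in_openN_strong /= xpair_eqE !inE !eqxx /=.
    by case: eqVneq => [->|_]; rewrite ?adj_irrefl ?andbT.
  apply: outside => z Dz; rewrite !inE negb_or adj_sym (allP nadj) // andbT.
  by apply: contraNneq Dd => ->.
exists (L ++ [seq (d, h) | h <- S']); split; last 2 first.
- exact: inD.
- rewrite size_cat size_map sizeL a_num_rcons (negbTE adj_d) size_rcons addn0.
  by rewrite subSn // mulSn -addnA (addnC (size S')).
(* An earlier neighbor [z] of [d] covers [d] but not [x]. *)
have xd : x != d.
  have /allPn[z Dz /negPn] := adj_d; rewrite adj_sym => zd.
  by apply: contraNneq (Dx z Dz) => ->; rewrite !inE zd orbT.
(* The new vertices lie over [x], the terms over [d], so they never coincide and closed
   neighborhoods of [H] appear. *)
apply: (@legal_cat_map _ _ (@closedN H) _ _ (pair x)) => // [u y|p y].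
  by rewrite in_openN_strong /= dx xpair_eqE (negbTE xd) andbT.
exact: outside.
Qed.

Theorem theorem4p4 (G H : sgraph) :
  max_seq (@dominating_seq G)
    (fun D : seq G =>
       grundy_total H * a_num D + (#|[set x in D]| - a_num D) * grundy H)
  <= grundy_total (strong_product G H).
Proof.
(* The empty sequence is legal, so all three maxima are attained, even if [H] has no edges. *)
have [||D domD ->] := @max_seq_attained G (@dominating_seq G) (fun D : seq G =>
  grundy_total H * a_num D + (#|[set x in D]| - a_num D) * grundy H) [::].
- by move=> t; apply: legal_uniq.
- exact: legal_nil.
have [||S legS ES] := @max_seq_attained H (@legal_open_seq H) size [::].
- by move=> t; apply: legal_uniq.
- exact: legal_nil.
have [||S' legS' ES'] := @max_seq_attained H (@dominating_seq H) size [::].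
- by move=> t; apply: legal_uniq.
- exact: legal_nil.
have [L [legL _ sizeL]] := strong_legal_seq legS legS' domD.
rewrite /grundy_total ES /grundy ES' cardsE (card_uniqP (legal_uniq domD)).
rewrite -sizeL; apply: max_seq_geq legL => t; exact: legal_uniq.
Qed.
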